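(* Let $t\geq2$ and $n\ge0$ be integers, and let $a_t(n):=\sum_{\lambda\vdash n}|\lambda_{(t)}|$ be the sum of the sizes of the $t$-cores of all partitions of $n$. Then \[ a_t(n) = n\,p(n)-t\sum_{\substack{0\leq j\leq n\\ t\mid j}}j\,p\left(\frac jt\right)p_t(n-j), \] where $p(m)$ is the number of partitions of $m$ and $p_t(m)$ is the number of $t$-regular partitions of $m$.
   Context: Partitions: $|\lambda|$ is the sum of the parts of a partition $\lambda$, with $|\emptyset|=0$ for the empty partition, and $\lambda\vdash n$ means $|\lambda|=n$; $p(0)=p_t(0)=1$. A $t$-core is a partition none of whose hook lengths is divisible by $t$. The $t$-core $\lambda_{(t)}$ of $\lambda$ is the $t$-core obtained from $\lambda$ by successively removing (rim) hooks of length divisible by $t$ until none remain (the result is independent of choices). A partition is $t$-regular if none of its parts is divisible by $t$. *)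

(* Defs.v *)
From HB Require Import structures.
From mathcomp Require Import all_boot.

Set Implicit Arguments.
Unset Strict Implicit.
Unset Printing Implicit Defensive.

(* A partition is the nonincreasing sequence of its (positive) parts; the
   empty partition is [::], and |l| is sumn l. *)
Definition is_partition (l : seq nat) : bool := sorted geq l && (0 \notin l).

Record partn (n : nat) := PartN {
  parts :> seq nat;
  partsP : is_partition parts && (sumn parts == n)
}.

HB.instance Definition _ n := [isSub for @parts n].
HB.instance Definition _ n := [Countable of partn n by <:].

Lemma leq_sumn (l : seq nat) x : x \in l -> x <= sumn l.
Proof.
elim: l => //= y l IH; rewrite inE => /orP [/eqP -> | /IH]; first exact: leq_addr.
by move/leq_trans; apply; exact: leq_addl.
Qed.

Lemma size_sumn (l : seq nat) : 0 \notin l -> size l <= sumn l.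
Proof.
elim: l => //= y l IH; rewrite inE negb_or => /andP [y0 /IH].
by rewrite -add1n => h; apply: leq_add => //; rewrite lt0n eq_sym.
Qed.

(* Parts and length of a partition of n are at most n, so that partn n embeds
   in a finite type. *)
Definition partn_bseq n (l : partn n) : n.-bseq 'I_n.+1 :=
  insub_bseq n (map inord (parts l)).

Definition bseq_partn n (b : n.-bseq 'I_n.+1) : option (partn n) :=
  insub (map val b).

Lemma partn_bseqK n : pcancel (@partn_bseq n) (@bseq_partn n).
Proof.
move=> l; have /andP [/andP [_ l0] /eqP sl] := partsP l.
rewrite /bseq_partn /partn_bseq.
have sz : size (map (@inord n) (parts l)) <= n.
  by rewrite size_map -[X in _ <= X]sl size_sumn.
rewrite /insub_bseq insubdK // -map_comp.
suff -> : [seq (val \o @inord n) i | i <- l] = parts l by rewrite valK.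
rewrite -[RHS]map_id; apply/eq_in_map => x xl /=.
by rewrite inordK // ltnS -sl leq_sumn.
Qed.

HB.instance Definition _ n : isFinite (partn n) := PCanIsFinite (@partn_bseqK n).

(* The cells (row, column) of the Young diagram, both counted from 0. *)
Definition cells (l : seq nat) : seq (nat * nat) :=
  [seq (i, j) | i <- iota 0 (size l), j <- iota 0 (nth 0 l i)].

Definition arm (l : seq nat) (x : nat * nat) : nat := nth 0 l x.1 - x.2.+1.

Definition leg (l : seq nat) (x : nat * nat) : nat :=
  count (fun part => x.2 < part) (drop x.1.+1 l).

Definition hook_length (l : seq nat) (x : nat * nat) : nat :=
  (arm l x + leg l x).+1.

Definition is_core (t : nat) (l : seq nat) : bool :=
  all (fun x => ~~ (t %| hook_length l x)) (cells l).

(* The rim hook attached to the cell x of l: the cells y of l weakly below and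
   to the right of x such that the diagonal successor of y is not in l. *)
Definition in_rim_hook (l : seq nat) (x y : nat * nat) : bool :=
  [&& y \in cells l, x.1 <= y.1, x.2 <= y.2 & (y.1.+1, y.2.+1) \notin cells l].

Definition remove_rim_hook (l : seq nat) (x : nat * nat) : seq nat :=
  [seq part <- mkseq (fun i => count (fun j => ~~ in_rim_hook l x (i, j))
                                     (iota 0 (nth 0 l i))) (size l) | 0 < part].

(* One removal, at the first cell in row-reading order whose hook length is
   divisible by t; the identity on t-cores. *)
Definition core_step (t : nat) (l : seq nat) : seq nat :=
  if [seq x <- cells l | t %| hook_length l x] is x :: _
  then remove_rim_hook l x else l.

(* Each removal lowers the size, so sumn l steps reach a t-core: see core_core.
   The resulting t-core does not depend on the order of the removals, so fixing
   one in core_step is harmless. *)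
Definition core (t : nat) (l : seq nat) : seq nat :=
  iter (sumn l) (core_step t) l.

Lemma mem_cells l i j : ((i, j) \in cells l) = (j < nth 0 l i).
Proof.
apply/allpairsPdep/idP => [[i' [j' [_ hj [-> ->]]]]|h].
  by move: hj; rewrite mem_iota.
exists i, j; split=> //; last by rewrite mem_iota.
rewrite mem_iota /= add0n ltnNge; apply/negP => /(nth_default 0) e.
by rewrite e in h.
Qed.

Lemma partition_nth l i : is_partition l -> nth 0 l i.+1 <= nth 0 l i.
Proof.
case/andP => /(sortedP 0) h _; case: (ltnP i.+1 (size l)) => [/h //|hs].
by rewrite nth_default.
Qed.

Lemma remove_rim_hook_partition l x :
  is_partition l -> is_partition (remove_rim_hook l x).
Proof.
move=> pl; apply/andP; split; last by rewrite mem_filter.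
apply: sorted_filter => [a b c /= h1 h2|]; first exact: leq_trans h2 h1.
apply/(sortedP 0) => i; rewrite size_mkseq => hi.
rewrite !nth_mkseq ?(ltnW hi) //= /geq /=.
rewrite -(subnKC (partition_nth i pl)) iotaD count_cat.
apply: leq_trans (leq_addr _ _).
have : subpred [pred j | (j < nth 0 l i.+1) && ~~ in_rim_hook l x (i.+1, j)]
               (fun j => ~~ in_rim_hook l x (i, j)).
  move=> j /andP [hj]; rewrite /in_rim_hook !mem_cells /= hj /= => /negP h.
  apply/negP => /and4P [_ h1 h2 h3]; apply: h.
  rewrite (leqW h1) h2 -leqNgt; move: h3; rewrite -leqNgt; apply: leq_trans.
  exact: partition_nth.
move/sub_count/(_ (iota 0 (nth 0 l i.+1))); apply: leq_trans.
apply/eq_leq/eq_in_count => j; rewrite mem_iota add0n => /andP [_ hj] /=.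
by rewrite hj.
Qed.

Lemma sumn_remove_rim_hook l x :
  is_partition l -> x \in cells l -> sumn (remove_rim_hook l x) < sumn l.
Proof.
case: x => i j pl; rewrite mem_cells => hj.
have hi : i < size l.
  by rewrite ltnNge; apply/negP => /(nth_default 0) e; rewrite e in hj.
have filt s : sumn [seq y <- s | 0 < y] = sumn s.
  by elim: s => //= -[|y] s IH //=; rewrite IH.
rewrite /remove_rim_hook filt -[in X in _ < X](mkseq_nth 0 l) /mkseq.
have -> : iota 0 (size l) = index_iota 0 (size l) by rewrite /index_iota subn0.
rewrite !sumnE !big_map.
rewrite !big_mkord (bigD1 (Ordinal hi)) //= [X in _ < X](bigD1 (Ordinal hi)) //=.
rewrite -addSn; apply: leq_add; last first.
  by apply: leq_sum => k _; rewrite (leq_trans (count_size _ _)) ?size_iota.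
rewrite -[X in _ < X](size_iota 0) -[X in _ < X](count_predC (in_rim_hook l (i, j) \o pair i)).
rewrite -[X in X < _]add0n ltn_add2r -has_count.
apply/hasP; exists (nth 0 l i).-1; rewrite ?mem_iota /in_rim_hook ?mem_cells /=.
  by rewrite add0n prednK // (leq_ltn_trans _ hj).
have h0 : 0 < nth 0 l i by apply: leq_ltn_trans hj.
apply/and4P; split=> //=; rewrite ?mem_cells ?prednK // -?leqNgt ?partition_nth //.
by rewrite -ltnS prednK.
Qed.

Lemma core_step_id t l : is_core t l -> core_step t l = l.
Proof.
rewrite /is_core /core_step => /allP h.
case e : [seq x <- cells l | _] => [//|x s].
have : x \in [seq x <- cells l | t %| hook_length l x] by rewrite e mem_head.
by rewrite mem_filter => /andP [h1 /h]; rewrite h1.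
Qed.

Lemma core_stepP t l : is_partition l -> ~~ is_core t l ->
  exists2 x, (x \in cells l) && (t %| hook_length l x) &
             core_step t l = remove_rim_hook l x.
Proof.
rewrite /is_core -has_predC /core_step => pl.
case e : [seq x <- cells l | _] => [|x s].
  move=> /hasP [y hy /=]; rewrite negbK => h.
  have : y \in [seq x <- cells l | t %| hook_length l x] by rewrite mem_filter h.
  by rewrite e.
move=> _; exists x => //.
have : x \in [seq x <- cells l | t %| hook_length l x] by rewrite e mem_head.
by rewrite mem_filter andbC.
Qed.

Lemma core_core t l : is_partition l ->
  is_partition (core t l) && is_core t (core t l).
Proof.
rewrite /core; move: {2 3 4}(sumn l) (leqnn (sumn l)) => m.
elim: m l => [|m IH] l hm pl.
  rewrite /= pl; apply/allP => x /(sumn_remove_rim_hook pl).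
  by move: hm; rewrite leqn0 => /eqP ->.
case: (boolP (is_core t l)) => hc.
  have -> : iter m.+1 (core_step t) l = l.
    by elim: m.+1 => //= k ->; exact: core_step_id.
  by rewrite pl.
have [x /andP [hx _] e] := core_stepP pl hc.
rewrite iterSr e; apply: IH; last exact: remove_rim_hook_partition.
by rewrite -ltnS (leq_trans (sumn_remove_rim_hook pl hx)).
Qed.

Definition regular (t : nat) (l : seq nat) : bool :=
  all (fun part => ~~ (t %| part)) l.

Definition num_partn (n : nat) : nat := #|{: partn n}|.

Definition num_regular (t n : nat) : nat := #|[set l : partn n | regular t l]|.

Definition core_size_sum (t n : nat) : nat :=
  \sum_(l : partn n) sumn (core t l).

(* Main.v *)
Require Import Defs.
From mathcomp Require Import all_boot all_order all_algebra.
From mathcomp Require Import zify.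

Set Implicit Arguments.
Unset Strict Implicit.
Unset Printing Implicit Defensive.

(** The formula is read as the statement that the quantity
    t * \sum_j j p(j/t) p_t(n-j) is the total size lost when every partition
    of n is reduced to its t-core.  Three facts give this.

    (1) Each partition l satisfies |core t l| + t * w(l) = |l|, where w(l)
    is the number of cells of l whose hook length is divisible by t
    (sumn_core).  Encode l by its beta-set, N distinct numbers seen as beads
    on the line of naturals.  The hooks in a row correspond to the empty
    positions below the bead b of that row, a hook of length h to the
    position b - h (perm_hooks_iota), and stripping the corresponding rim
    hook slides the bead from b to b - h (perm_beta_remove_rim_hook).  Counting
    positions congruent to b below b writes w(l) as the sum of the quotients
    b %/ t minus a term that sees only the residues of the beads
    (weight_beta).  A slide by a multiple h of t keeps the residues, so it
    lowers w by h / t while it lowers the size by h.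

    (2) For k > 0 let S_k(n) count the hooks of length k, and T_k(n) the parts
    equal to k, over all partitions of n.  Then S_k(n) = k * T_k(n)
    (hooks_sum_mult), because both sides obey the same recursion.  Sliding
    one bead down by k pairs the hooks of length k of the partitions of n with
    the ways to slide a bead up by k in a partition of n - k, and each
    partition has exactly k more upward slides than downward ones once its
    beta-set contains the k lowest positions (hooks_addable), whence S_k(n) =
    S_k(n-k) + k p(n-k) (hooks_sum_rec).  Deleting one part k gives
    T_k(n) = T_k(n-k) + p(n-k) (mult_sum_rec).  Summing over the multiples k
    of t, the sum of w(l) over the partitions l of n is the sum of all their
    parts divisible by t (sum_weight).

    (3) A partition of n is the union of t times a partition of some m and a
    t-regular partition of n - tm.  Grouping the partitions of n by the sum
    j = tm of their parts divisible by t turns the sum obtained in (2) into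
    \sum_j j p(j/t) p_t(n-j) (sum_div_part_sum). *)

(** * Partitions as sorted sequences *)

Lemma geq_total : total geq.
Proof. by move=> a b; exact: leq_total. Qed.

Lemma geq_trans : transitive geq.
Proof. by move=> a b c /= h1 h2; exact: leq_trans h2 h1. Qed.

Lemma geq_anti : antisymmetric geq.
Proof. by move=> a b; rewrite andbC => /anti_leq. Qed.

Lemma is_partition_cons x l :
  is_partition (x :: l) = [&& 0 < x, all (geq x) l & is_partition l].
Proof.
rewrite /is_partition /= path_sortedE; last exact: geq_trans.
by rewrite in_cons negb_or eq_sym -lt0n; case: (0 < x); rewrite ?andbF //= andbA.
Qed.

Lemma nth_partition_leq l a b : is_partition l -> a <= b -> nth 0 l b <= nth 0 l a.
Proof.
move=> pl /subnKC <-; elim: (b - a) => [|d IH]; first by rewrite addn0.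
by rewrite addnS; apply: leq_trans IH; exact: partition_nth.
Qed.

Lemma size_partition l : is_partition l -> size l <= sumn l.
Proof. by case/andP => _; exact: size_sumn. Qed.

Lemma is_partition_sort s : is_partition (sort geq s) = (0 \notin s).
Proof. by rewrite /is_partition mem_sort sort_sorted //; exact: geq_total. Qed.

Lemma perm_partition s s' : is_partition s -> is_partition s' -> perm_eq s s' -> s = s'.
Proof.
move=> /andP [h _] /andP [h' _]; exact: (sorted_eq geq_trans geq_anti).
Qed.

(** In a nonincreasing sequence the zeros come last, so dropping them does not
    shift the other entries. *)
Lemma nth_filter_gt0 s i : (forall i, nth 0 s i.+1 <= nth 0 s i) ->
  nth 0 [seq x <- s | 0 < x] i = nth 0 s i.
Proof.
elim: s i => //= x s IH i h; case: (posnP x) => [x0|xp].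
  have s0 j : nth 0 s j = 0.
    elim: j => [|j IHj]; first by have := h 0; rewrite /= x0; lia.
    by have := h j.+1; rewrite /= IHj; lia.
  rewrite IH; last by move=> j; exact: h j.+1.
  by case: i => [|i] /=; rewrite !s0 ?x0.
by case: i => [|i] //=; rewrite IH // => j; exact: h j.+1.
Qed.

Lemma partnP n (l : Defs.partn n) : is_partition l /\ sumn l = n.
Proof. by have /andP [? /eqP] := partsP l. Qed.

(** * Hook lengths and beta-sets *)

(** The number of parts exceeding j is the length of column j, that is, part j
    of the conjugate partition; both sides say that (a, j) is a cell. *)
Lemma ltn_nth_conj l j a : is_partition l -> (j < nth 0 l a) = (a < count (ltn j) l).
Proof.
elim: l a => [|x l IH] a; first by rewrite nth_nil.
rewrite is_partition_cons => /and3P [_ /allP xl pl] /=.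
case: (ltnP j x) => hj; case: a => [|a] //=; first by rewrite IH.
all: rewrite ?IH //; have -> : count (ltn j) l = 0; last by rewrite ?ltn0 // ltnNge hj.
all: apply/eqP; rewrite -leqn0 leqNgt -has_count.
all: by apply/hasPn => y /xl /= hy; rewrite -leqNgt (leq_trans hy).
Qed.

(** The symmetric form of the hook length, with the leg read off the conjugate
    partition; stated additively to avoid truncated subtraction. *)
Lemma hook_length_conj l i j : is_partition l -> j < nth 0 l i ->
  hook_length l (i, j) + (i + j) + 1 = nth 0 l i + count (ltn j) l.
Proof.
move=> pl hj; rewrite /hook_length /arm /leg /=.
have hi : i < size l by rewrite ltnNge; apply/negP => /(nth_default 0) e; rewrite e in hj.
have : count (ltn j) l = i.+1 + count (fun part => j < part) (drop i.+1 l).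
  rewrite -[in LHS](cat_take_drop i.+1 l) count_cat; congr (_ + _).
  rewrite -[RHS](_ : size (take i.+1 l) = _); last by rewrite size_takel.
  apply/eqP; rewrite -all_count; apply/(all_nthP 0) => a.
  rewrite size_takel // => ha; rewrite nth_take //=.
  by apply: leq_trans hj _; exact: nth_partition_leq.
by lia.
Qed.

(** A staircase is added to the parts, padded with zeros to N of them, to make
    them distinct. *)
Definition bead (N : nat) (l : seq nat) (i : nat) : nat := nth 0 l i + (N - i.+1).

Definition beta (N : nat) (l : seq nat) : seq nat := mkseq (bead N l) N.

Lemma size_beta N l : size (beta N l) = N.
Proof. exact: size_mkseq. Qed.

Lemma ltn_bead N l i i' : is_partition l -> i < i' -> i' < N -> bead N l i' < bead N l i.
Proof.
move=> pl h1 h2; have := nth_partition_leq pl (ltnW h1); rewrite /bead; lia.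
Qed.

Lemma bead_inj N l i i' : is_partition l -> i < N -> i' < N ->
  bead N l i = bead N l i' -> i = i'.
Proof.
move=> pl h1 h2; case: (ltngtP i i') => // h e.
- by have := ltn_bead pl h h2; rewrite e ltnn.
- by have := ltn_bead pl h h1; rewrite e ltnn.
Qed.

Lemma beta_uniq N l : is_partition l -> uniq (beta N l).
Proof. by move=> pl; apply/mkseq_uniqP => i i'; rewrite !inE; apply: bead_inj. Qed.

Lemma mem_beta N l i : i < N -> bead N l i \in beta N l.
Proof. by move=> hi; apply: map_f; rewrite mem_iota. Qed.

Lemma sumn_beta N l : size l <= N -> sumn (beta N l) = sumn l + 'C(N, 2).
Proof.
move=> hN; rewrite /beta /mkseq sumnE big_map.
rewrite -{1}[N]subn0 -[iota _ _]/(index_iota 0 N) big_split /=; congr (_ + _).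
  rewrite (big_cat_nat (n := size l)) //= [X in _ + X]big1_seq ?addn0.
    by rewrite -[in RHS](mkseq_nth 0 l) /mkseq sumnE big_map /index_iota subn0.
  by move=> i; rewrite mem_index_iota => /andP [_ /andP [h _]]; rewrite nth_default.
rewrite big_nat_rev /= -bin2_sum !big_nat; apply: eq_bigr => i hi; lia.
Qed.

(** The positions below a bead are either empty, and then at a distance which
    is a hook length of the row, or occupied by a later bead.  As the hook
    length of (i, j) is the distance to j + N - (length of column j), this says
    that these column positions avoid the beads. *)
Lemma perm_hooks_iota N l i : is_partition l -> size l <= N -> i < N ->
  perm_eq ([seq hook_length l (i, j) | j <- iota 0 (nth 0 l i)] ++
           [seq bead N l i - bead N l i' | i' <- iota i.+1 (N - i.+1)])
          (iota 1 (bead N l i)).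
Proof.
move=> pl hN hi; set s1 := map _ _; set s2 := map _ _.
have conjN j : count (ltn j) l <= N by apply: leq_trans hN; exact: count_size.
have hook_gt0 x : 0 < hook_length l x by [].
(* There are exactly bead N l i entries, so distinctness and the range suffice. *)
have hU : uniq (s1 ++ s2).
  rewrite cat_uniq; apply/and3P; split.
  - rewrite map_inj_in_uniq ?iota_uniq // => j j'; rewrite !mem_iota /= !add0n => hj hj' e.
    have := hook_length_conj pl hj; have := hook_length_conj pl hj'; rewrite e.
    case: (ltngtP j j') => // h.
      have : count (ltn j') l <= count (ltn j) l by apply: sub_count => x /=; lia.
      by lia.
    have : count (ltn j) l <= count (ltn j') l by apply: sub_count => x /=; lia.
    by lia.
  - apply/hasPn => x /mapP [i']; rewrite mem_iota => hi' ->; apply/negP => /mapP [j].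
    rewrite mem_iota /= add0n => hj; have := hook_length_conj pl hj.
    have hlt : bead N l i' < bead N l i by apply: ltn_bead => //; lia.
    move=> h1 e; move: h1; rewrite -e; move: hlt; rewrite /bead.
    by have := ltn_nth_conj j i' pl; have := conjN j; lia.
  - rewrite map_inj_in_uniq ?iota_uniq // => a b; rewrite !mem_iota => ha hb e.
    have h1 : bead N l a < bead N l i by apply: ltn_bead => //; lia.
    have h2 : bead N l b < bead N l i by apply: ltn_bead => //; lia.
    by apply: (@bead_inj N l) => //; lia.
have hsub : {subset s1 ++ s2 <= iota 1 (bead N l i)}.
  move=> x; rewrite mem_cat mem_iota => /orP [] /mapP [j]; rewrite mem_iota => hj ->.
    have hj' : j < nth 0 l i by lia.
    have := hook_length_conj pl hj'; rewrite /bead; have := conjN j.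
    by have := hook_gt0 (i, j); move: (hook_length l (i, j)) => h; lia.
  have : bead N l j < bead N l i by apply: ltn_bead => //; lia.
  by lia.
apply: uniq_perm; rewrite ?iota_uniq //.
have [|//] := uniq_min_size hU hsub.
by rewrite size_cat !size_map !size_iota /bead.
Qed.

Lemma count_cells (a : pred (nat * nat)) N l : size l <= N ->
  count a (cells l) = \sum_(i < N) count (fun j => a (i : nat, j)) (iota 0 (nth 0 l i)).
Proof.
move=> hN; rewrite /cells count_flatten sumnE !big_map.
rewrite -{1}[size l]subn0 -[iota _ _]/(index_iota 0 (size l)).
rewrite -(big_mkord xpredT (fun i => count (fun j => a (i, j)) (iota 0 (nth 0 l i)))).
rewrite [RHS](big_cat_nat (n := size l)) //= [X in _ = _ + X]big1_seq ?addn0.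
  by apply: eq_bigr => i _; rewrite count_map.
by move=> i; rewrite mem_index_iota => /andP [_ /andP [h _]]; rewrite nth_default.
Qed.

Lemma sum_beta (F : nat -> nat) N l :
  \sum_(b <- beta N l) F b = \sum_(i < N) F (bead N l i).
Proof.
by rewrite big_map -(big_mkord xpredT (fun i => F (bead N l i))) /index_iota subn0.
Qed.

(** The previous partition of the positions below a bead, counted through an
    arbitrary predicate: used with divisibility by t and with equality to k. *)
Lemma count_hooks (a : pred nat) N l : is_partition l -> size l <= N ->
  count (fun x => a (hook_length l x)) (cells l) +
    \sum_(i < N) \sum_(i' < N) (i < i') * a (bead N l i - bead N l i') =
  \sum_(b <- beta N l) count a (iota 1 b).
Proof.
move=> pl hN; rewrite (count_cells _ hN) -big_split /= sum_beta.
apply: eq_bigr => i _.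
rewrite -(permP (perm_hooks_iota pl hN (ltn_ord i))) count_cat !count_map; congr (_ + _).
rewrite -sum1_count -[iota _ _]/(index_iota i.+1 N) big_geq_mkord [RHS]big_mkcond /=.
by apply: eq_bigr => i' _ /=; case: (i < i'); rewrite ?andbF // andbT; case: (a _).
Qed.

(** * The size of the core *)

Definition weight (t : nat) (l : seq nat) : nat :=
  count (fun x => t %| hook_length l x) (cells l).

(** Ordered pairs are counted, diagonal included: this makes the count
    a function of the multiset of residues alone. *)
Definition congruent_pairs (t : nat) (s : seq nat) : nat :=
  \sum_(x <- s) \sum_(y <- s) (x == y %[mod t]).

(** Below a bead b there are b %/ t positions at a distance divisible by t; the
    occupied ones among them are the congruent pairs of beads, which
    congruent_pairs counts twice, together with N diagonal pairs. *)
Lemma weight_beta t N l : is_partition l -> size l <= N ->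
  (weight t l).*2 + congruent_pairs t (beta N l) = (\sum_(b <- beta N l) b %/ t).*2 + N.
Proof.
move=> pl hN.
have -> : \sum_(b <- beta N l) b %/ t = \sum_(b <- beta N l) count (dvdn t) (iota 1 b).
  apply: eq_bigr => b _; rewrite divn_count_dvd -sum1_count [RHS]big_mkcond /=.
  rewrite /index_iota subn1 /=.
  by apply: eq_bigr => i _; case: (t %| i).
rewrite -(count_hooks (dvdn t) pl hN) doubleD -/(weight t l) -addnA; congr (_ + _).
set D := \sum_(i < N) _.
have cE (i i' : 'I_N) : (bead N l i == bead N l i' %[mod t]) =
   (i < i') * (t %| bead N l i - bead N l i') + (i' < i) * (t %| bead N l i' - bead N l i)
   + (i' == i) :> nat.
  rewrite -(inj_eq val_inj i' i) /=.
  case: (ltngtP i i') => h.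
  - by rewrite eqn_mod_dvd ?mul1n ?addn0 // ltnW // ltn_bead.
  - by rewrite eq_sym eqn_mod_dvd ?mul1n ?addn0 // ltnW // ltn_bead.
  - by rewrite h eqxx.
rewrite /congruent_pairs sum_beta.
under eq_bigr => i _ do rewrite sum_beta (eq_bigr _ (fun i' _ => cE i i')) !big_split /=.
rewrite !big_split /= -addnn; congr (_ + _ + _).
  by rewrite exchange_big.
rewrite (eq_bigr (fun=> 1)) ?sum_nat_const ?card_ord ?muln1 // => i _.
by rewrite (bigD1 i) //= eqxx big1 ?addn0 // => i' /negbTE ->.
Qed.

(** From row i on, a row keeps the cells left of column j and those whose
    diagonal successor is still in the diagram. *)
Lemma nth_remove_rim_hook l i j a : is_partition l ->
  nth 0 (remove_rim_hook l (i, j)) a =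
  if a < i then nth 0 l a else minn (nth 0 l a) (maxn j (nth 0 l a.+1).-1).
Proof.
move=> pl.
set row := fun b => count (fun c => ~~ in_rim_hook l (i, j) (b, c)) (iota 0 (nth 0 l b)).
have rowE b : nth 0 (mkseq row (size l)) b =
  if b < i then nth 0 l b else minn (nth 0 l b) (maxn j (nth 0 l b.+1).-1).
  case: (ltnP b (size l)) => hb; last first.
    by rewrite [LHS]nth_default ?size_mkseq // (nth_default 0 hb) min0n if_same.
  rewrite nth_mkseq // /row; case: (ltnP b i) => hbi.
    rewrite (eq_count (a2 := predT)) ?count_predT ?size_iota // => c.
    by rewrite /in_rim_hook /= (leqNgt i) hbi /= andbF.
  set m := maxn _ _.
  rewrite (eq_in_count (a2 := fun c => c < m)); last first.
    move=> c; rewrite mem_iota /= add0n => hc.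
    rewrite /in_rim_hook !mem_cells /= hc hbi /= negb_and negbK -ltnNge /m.
    by apply/idP/idP; lia.
  elim: (nth 0 l b) => [|c IHc]; first by rewrite min0n.
  by rewrite -addn1 iotaD count_cat IHc /= add0n; lia.
rewrite /remove_rim_hook -/row nth_filter_gt0 // => b; rewrite !rowE.
have := partition_nth b pl; have := partition_nth b.+1 pl.
by case: (ltnP b.+1 i); case: (ltnP b i); lia.
Qed.

Lemma size_remove_rim_hook l x : size (remove_rim_hook l x) <= size l.
Proof. by rewrite size_filter (leq_trans (count_size _ _)) // size_mkseq. Qed.

(** Stripping the rim hook shifts each row that it meets, except the last, to
    the next row minus one cell: the corresponding beads are renumbered but do
    not move.  The last such row is cut to length j, and its bead
    becomes the empty position that the hook of (i, j) points to. *)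
Lemma perm_beta_remove_rim_hook N l i j :
  is_partition l -> size l <= N -> j < nth 0 l i ->
  perm_eq (beta N (remove_rim_hook l (i, j)))
          (bead N l i - hook_length l (i, j) :: rem (bead N l i) (beta N l)).
Proof.
move=> pl hN hj.
have ltN a : j < nth 0 l a -> a < N.
  by rewrite ltn_nth_conj // => h; apply: leq_trans h (leq_trans (count_size _ _) hN).
have hi := ltN i hj.
have pm := remove_rim_hook_partition (i, j) pl.
have hk := hook_length_conj pl hj.
have cN : count (ltn j) l <= N by apply: leq_trans hN; exact: count_size.
set g := bead N l i - _.
have gE : g + count (ltn j) l = j + N.
  by rewrite /g /bead; have := ltn_nth_conj j i pl; lia.
set m := remove_rim_hook l (i, j) in pm *; set r := g :: _.
have hsub : {subset beta N m <= r}.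
  move=> x /mapP [a]; rewrite mem_iota /= add0n => ha.
  move=> ->; rewrite in_cons mem_rem_uniq ?beta_uniq // inE.
  have keep c : c < N -> c != i ->
      (bead N l c != bead N l i) && (bead N l c \in beta N l).
    by move=> hc ci; rewrite mem_beta // andbT; apply: contraNneq ci => /bead_inj ->.
  rewrite [in X in X || _]/bead [in X in _ || X]/bead /m nth_remove_rim_hook //.
  case: (ltnP a i) => hai; first by rewrite keep ?orbT // ltn_eqF.
  have h1 := partition_nth a pl.
  have c1 := ltn_nth_conj j a pl; have c2 := ltn_nth_conj j a.+1 pl.
  case: (ltnP j (nth 0 l a.+1)) => hj1.
    have ha1 := ltN _ hj1.
    rewrite (_ : _ + _ = bead N l a.+1); last by rewrite /bead; lia.
    by rewrite keep ?orbT // neq_ltn ltnS hai orbT.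
  case: (ltnP j (nth 0 l a)) => hj2.
    by rewrite (_ : _ + _ = g) ?eqxx //; lia.
  rewrite (_ : _ + _ = bead N l a); last by rewrite /bead; lia.
  by rewrite keep ?orbT //; apply: contraTneq hj => <-; rewrite -leqNgt.
have hsz : size r <= size (beta N m).
  by rewrite /= size_rem ?mem_beta // !size_beta prednK // (leq_ltn_trans _ hi).
have [_ eqm] := uniq_min_size (beta_uniq N pm) hsub hsz.
apply: uniq_perm => //; first exact: beta_uniq.
rewrite -(eq_uniq _ eqm) ?beta_uniq //; apply/eqP.
by rewrite eqn_leq hsz uniq_leq_size ?beta_uniq.
Qed.

Lemma perm_congruent_pairs t s1 s2 :
  perm_eq (map (modn^~ t) s1) (map (modn^~ t) s2) ->
  congruent_pairs t s1 = congruent_pairs t s2.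
Proof.
have mapE s : congruent_pairs t s =
    \sum_(x <- map (modn^~ t) s) \sum_(y <- map (modn^~ t) s) (x == y).
  by rewrite big_map; apply: eq_bigr => x _; rewrite big_map.
move=> h; rewrite !mapE (perm_big _ h); apply: eq_bigr => x _; exact: perm_big.
Qed.

(** The slide of a bead by h, a multiple of t, lowers the size by h and the
    weight by h / t: the quantity |l| - t * weight t l is invariant. *)
Lemma weight_remove_rim_hook t l x :
  0 < t -> is_partition l -> x \in cells l -> t %| hook_length l x ->
  sumn (remove_rim_hook l x) + t * weight t l =
  sumn l + t * weight t (remove_rim_hook l x).
Proof.
case: x => i j t0 pl; rewrite mem_cells => hj hd.
set m := remove_rim_hook _ _; set h := hook_length _ _ in hd *.
have pm : is_partition m by exact: remove_rim_hook_partition.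
set N := size l; have hm : size m <= N by exact: size_remove_rim_hook.
have hi : i < N by rewrite /N ltnNge; apply/negP => /(nth_default 0) e; rewrite e in hj.
have hb : h <= bead N l i.
  have := hook_length_conj pl hj; rewrite -/h /bead.
  by have : count (ltn j) l <= N by [exact: count_size]; lia.
have := perm_beta_remove_rim_hook pl (leqnn N) hj; rewrite -/m -/h.
set s := rem _ _ => perm_m.
have perm_l : perm_eq (beta N l) (bead N l i :: s) by apply: perm_to_rem; exact: mem_beta.
have sl := sumn_beta (leqnn N); have sm := sumn_beta hm.
rewrite (perm_sumn perm_l) /= in sl; rewrite (perm_sumn perm_m) /= in sm.
have wl := weight_beta t pl (leqnn N); have wm := weight_beta t pm hm.
rewrite (perm_big _ perm_l) big_cons in wl; rewrite (perm_big _ perm_m) big_cons in wm.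
have eC : congruent_pairs t (beta N m) = congruent_pairs t (beta N l).
  apply: perm_congruent_pairs; rewrite (permPl (perm_map _ perm_m)).
  rewrite perm_sym (permPl (perm_map _ perm_l)) /=.
  rewrite (_ : bead N l i %% t = (bead N l i - h) %% t) //.
  by rewrite -{1}(subnK hb) -modnDmr (eqP hd) addn0.
rewrite eC in wm.
have hq : bead N l i %/ t = (bead N l i - h) %/ t + h %/ t.
  by rewrite -{1}(subnK hb) divnDr.
have := divnK hd; move: (h %/ t) hq => q hq hqt.
have e : weight t l = weight t m + q by move: wl wm; rewrite hq /=; lia.
by rewrite e mulnDr [t * q]mulnC hqt; lia.
Qed.

(** The invariant is evaluated at the core, whose weight is 0. *)
Lemma sumn_core t l : 0 < t -> is_partition l ->
  sumn (core t l) + t * weight t l = sumn l.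
Proof.
move=> t0 pl.
have [_ /allP hc] := andP (core_core t pl).
have w0 : weight t (core t l) = 0.
  apply/eqP; rewrite -leqn0 leqNgt -has_count; apply/hasPn => x /hc //.
suff : sumn (core t l) + t * weight t l = sumn l + t * weight t (core t l).
  by rewrite w0 muln0 addn0.
rewrite /core; suff [] : is_partition (iter (sumn l) (core_step t) l) /\
  sumn (iter (sumn l) (core_step t) l) + t * weight t l =
  sumn l + t * weight t (iter (sumn l) (core_step t) l) by [].
elim: {1 2 4}(sumn l) => [|m [pm IH]] //=; set l' := iter _ _ _ in pm IH *.
case: (boolP (is_core t l')) => hl; first by rewrite core_step_id.
have [x /andP [hx hd] ->] := core_stepP pm hl.
split; first exact: remove_rim_hook_partition.
by have := weight_remove_rim_hook t0 pm hx hd; lia.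
Qed.

(** * Hooks of a given length over all partitions of n *)

Definition hooks (k : nat) (l : seq nat) : nat :=
  count (fun x => hook_length l x == k) (cells l).

Lemma sum_eq_mem (s : seq nat) x : uniq s -> \sum_(y <- s) (y == x) = (x \in s) :> nat.
Proof.
move=> us; rewrite -count_uniq_mem // -sum1_count [RHS]big_mkcond.
by apply: eq_bigr => y _ /=; case: eqP.
Qed.

(** A hook of length k is a bead b >= k with no bead at b - k; the beads b >= k
    with a bead at b - k = c are added back on the left. *)
Lemma hooks_beta k N l : 0 < k -> is_partition l -> size l <= N ->
  hooks k l + \sum_(c <- beta N l) (c + k \in beta N l) = \sum_(b <- beta N l) (k <= b).
Proof.
move=> k0 pl hN.
rewrite [RHS](eq_bigr (fun b => count (pred1 k) (iota 1 b))); last first.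
  by move=> b _; rewrite count_uniq_mem ?iota_uniq // mem_iota k0 add1n ltnS.
rewrite -(count_hooks (pred1 k) pl hN); congr (_ + _).
rewrite sum_beta exchange_big /=; apply: eq_bigr => i' _.
rewrite -sum_eq_mem ?beta_uniq // sum_beta; apply: eq_bigr => i _.
case: (ltngtP i i') => h.
- by have := ltn_bead pl h (ltn_ord i'); rewrite mul1n; lia.
- by have := ltn_bead pl h (ltn_ord i); lia.
- by rewrite h; lia.
Qed.

Lemma beta_ltn N l b : size l <= N -> sumn l <= N -> b \in beta N l -> b < N + N.
Proof.
move=> hN hs /mapP [i]; rewrite mem_iota /= add0n => hi ->; rewrite /bead.
suff : nth 0 l i <= sumn l by lia.
case: (ltnP i (size l)) => h; last by rewrite nth_default.
by apply: leq_sumn; exact: mem_nth.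
Qed.

Lemma sum_mem_ltn (F : nat -> nat) s M : uniq s -> (forall b, b \in s -> b < M) ->
  \sum_(c < M) ((c : nat) \in s) * F c = \sum_(c <- s) F c.
Proof.
move=> us hM.
rewrite (eq_bigr (fun c : 'I_M => \sum_(b <- s) (b == c) * F b)); last first.
  move=> c _; rewrite -sum_eq_mem // big_distrl /=; apply: eq_bigr => b _.
  by case: eqP => // ->.
rewrite exchange_big /= !big_seq; apply: eq_bigr => b hb.
rewrite (bigD1 (Ordinal (hM b hb))) //= eqxx mul1n big1 ?addn0 // => c.
by rewrite -(inj_eq val_inj) /= eq_sym => /negbTE ->.
Qed.

(** The lower position c ranges over a fixed interval rather than over the
    beta-set, so that the sum over c can be exchanged with a sum over
    partitions; with at most N beads and N columns all positions are below
    N + N. *)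
Lemma hooks_removable k N l : 0 < k -> is_partition l -> sumn l <= N ->
  \sum_(c < N + N) ((c : nat) \notin beta N l) && (c + k \in beta N l) = hooks k l.
Proof.
move=> k0 pl hN; have hs := leq_trans (size_partition pl) hN.
have ub := beta_uniq N pl; have bM b (hb : b \in beta N l) := beta_ltn hs hN hb.
apply: (@addIn (\sum_(c <- beta N l) (c + k \in beta N l))).
rewrite hooks_beta // -(sum_mem_ltn _ ub bM) -big_split /=.
rewrite (eq_bigr (fun c : 'I_(N + N) => \sum_(b <- beta N l) (b == c + k))); last first.
  by move=> c _; rewrite sum_eq_mem //; case: (_ \in _); case: (_ \in _).
rewrite exchange_big /= !big_seq; apply: eq_bigr => b /bM hb.
case: (leqP k b) => hk; last by rewrite big1 // => c _; lia.
have hbk : b - k < N + N by lia.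
rewrite (bigD1 (Ordinal hbk)) //= subnK // eqxx big1 // => c.
rewrite -(inj_eq val_inj) /=; lia.
Qed.

(** The excess k of upward over downward slides: both kinds arise from all
    beads, respectively all beads at positions >= k, by discarding those whose
    target is occupied, and the discarded pairs are the same.  The bound on N
    guarantees that the k lowest positions are all occupied. *)
Lemma hooks_addable k N l : 0 < k -> is_partition l -> sumn l + k <= N ->
  \sum_(c < N + N) ((c : nat) \in beta N l) && (c + k \notin beta N l) = hooks k l + k.
Proof.
move=> k0 pl hN.
have hs : size l + k <= N by have := size_partition pl; lia.
have hs' : size l <= N by lia.
have hN' : sumn l <= N by lia.
have ub := beta_uniq N pl; have bM b (hb : b \in beta N l) := beta_ltn hs' hN' hb.
under eq_bigr do rewrite -mulnb.
rewrite (sum_mem_ltn (fun c => c + k \notin beta N l) ub bM).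
have e1 : \sum_(c <- beta N l) (c + k \notin beta N l) +
          \sum_(c <- beta N l) (c + k \in beta N l) = N.
  rewrite -big_split /= -[RHS](size_beta N l) -sum1_size; apply: eq_bigr => c _.
  by case: (_ \in _).
have e2 : \sum_(b <- beta N l) (b < k) + \sum_(b <- beta N l) (k <= b) = N.
  rewrite -big_split /= -[RHS](size_beta N l) -sum1_size; apply: eq_bigr => c _.
  by case: ltnP.
have e3 : \sum_(b <- beta N l) (b < k) = k.
  rewrite sum_beta -[RHS](_ : \sum_(N - k <= i < N) 1 = k).
    rewrite big_geq_mkord [RHS]big_mkcond /=; apply: eq_bigr => i _.
    have -> : (bead N l i < k) = (N - k <= i); last by case: leqP.
    rewrite /bead; have hi := ltn_ord i.
    case: (ltnP i (size l)) => h; first by lia.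
    by rewrite nth_default //; lia.
  by rewrite sum_nat_const_nat; lia.
apply: (@addIn (\sum_(c <- beta N l) (c + k \in beta N l))).
by rewrite e1 addnAC hooks_beta // -[X in _ + X]e3 addnC e2.
Qed.

Definition debeta (s : seq nat) : seq nat :=
  [seq x <- mkseq (fun i => nth 0 s i - (size s - i.+1)) (size s) | 0 < x].

(** Any N distinct naturals are the beta-set of a partition: the difference with
    the staircase N-1, ..., 1, 0 is nonnegative and nonincreasing. *)
Lemma debetaP s : sorted gtn s ->
  [/\ is_partition (debeta s), size (debeta s) <= size s & beta (size s) (debeta s) = s].
Proof.
move=> ss; set N := size s.
have lt1 i : i.+1 < N -> nth 0 s i.+1 < nth 0 s i.
  by move=> hi; have /(sortedP 0) := ss; exact.
have ge i : i < N -> N - i.+1 <= nth 0 s i.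
  have [d] := ubnP (N - i.+1); elim: d i => // d IH i hd hi.
  case: (ltnP i.+1 N) => h; last by lia.
  by have := IH i.+1; have := lt1 i h; lia.
set f := mkseq (fun i => nth 0 s i - (N - i.+1)) N.
have fE i : nth 0 f i = nth 0 s i - (N - i.+1).
  case: (ltnP i N) => hi; first by rewrite nth_mkseq.
  by rewrite !nth_default ?size_mkseq.
have fdec i : nth 0 f i.+1 <= nth 0 f i.
  rewrite !fE; case: (ltnP i.+1 N) => hi; first by have := lt1 i hi; lia.
  by rewrite nth_default.
split.
- apply/andP; split; last by rewrite mem_filter.
  apply: sorted_filter => [|]; first exact: geq_trans.
  by apply/(sortedP 0) => i _; exact: fdec.
- by rewrite size_filter (leq_trans (count_size _ _)) // size_mkseq.
- apply: (@eq_from_nth _ 0); rewrite size_beta // => i hi.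
  rewrite nth_mkseq // /bead nth_filter_gt0 // fE subnK //; exact: ge.
Qed.

Lemma beta_inj N l l' : is_partition l -> is_partition l' ->
  size l <= N -> size l' <= N -> beta N l =i beta N l' -> l = l'.
Proof.
have bs m : is_partition m -> sorted gtn (beta N m).
  move=> pm; apply/(sortedP 0) => i; rewrite size_beta => hi.
  by rewrite !nth_mkseq ?(ltnW hi) //; apply: ltn_bead.
move=> pl pl' hl hl' e.
have {}e : beta N l = beta N l'.
  apply: (irr_sorted_eq (leT := gtn)) => //; try exact: bs.
  - by move=> a b c /= h1 h2; exact: ltn_trans h2 h1.
  - by move=> a /=; rewrite ltnn.
have en i : nth 0 l i = nth 0 l' i.
  case: (ltnP i N) => hi; last by rewrite !nth_default // (leq_trans _ hi).
  have := congr1 (nth 0 ^~ i) e; rewrite /= !nth_mkseq // /bead; lia.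
have sz : size l = size l'.
  have szE m : is_partition m -> size m = count (ltn 0) m.
    case/andP => _ m0; symmetry; apply/eqP; rewrite -all_count; apply/allP => x xm /=.
    by rewrite lt0n; apply: contraNneq m0 => <-.
  have eqc i : (i < size l) = (i < size l').
    by rewrite (szE _ pl) (szE _ pl') -!ltn_nth_conj // en.
  by have := eqc (size l); have := eqc (size l'); rewrite !ltnn; lia.
exact: (eq_from_nth (x0 := 0)).
Qed.

Definition move_bead (N c d : nat) (l : seq nat) : seq nat :=
  debeta (sort geq (c :: rem d (beta N l))).

Lemma move_beadP N l c d : is_partition l -> sumn l <= N ->
  c \notin beta N l -> d \in beta N l ->
  [/\ is_partition (move_bead N c d l), size (move_bead N c d l) <= N,
      sumn (move_bead N c d l) + d = sumn l + c &
      beta N (move_bead N c d l) =i c :: rem d (beta N l)].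
Proof.
move=> pl hN hc hd; have ub := beta_uniq N pl.
have hs := leq_trans (size_partition pl) hN.
rewrite /move_bead; set s := sort geq _.
have sz : size s = N.
  rewrite size_sort /= size_rem // size_beta prednK //.
  by rewrite -(size_beta N l); case: (beta N l) hd.
have ss : sorted gtn s.
  rewrite gtn_sorted_uniq_geq sort_uniq /= rem_uniq // andbT.
  rewrite (contra (@mem_rem _ _ _ _)) //=; apply: sort_sorted => a b; exact: leq_total.
have [pm sm bm] := debetaP ss; rewrite sz in sm bm.
split=> //; last by move=> x; rewrite bm mem_sort.
have := sumn_beta sm; rewrite bm (perm_sumn (permEl (perm_sort _ _))) /=.
have := sumn_beta hs; rewrite (perm_sumn (perm_to_rem hd)) /=; lia.
Qed.

(** Sliding a bead from d to c is injective.  The two sides are exchanged by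
    swapping c and d, so this inequality used in both directions gives the
    bijection without an explicit inverse. *)
Lemma leq_card_move_bead N n m c d : n <= N -> m + d = n + c ->
  #|[pred l : Defs.partn n | (c \notin beta N l) && (d \in beta N l)]| <=
  #|[pred l : Defs.partn m | (c \in beta N l) && (d \notin beta N l)]|.
Proof.
move=> hn e; set A := [pred l : Defs.partn n | _]; set B := [pred l : Defs.partn m | _].
have uA : uniq [seq move_bead N c d (parts l) | l <- enum A].
  rewrite map_inj_in_uniq ?enum_uniq // => l l'; rewrite !mem_enum !inE.
  move=> /andP [hc hd] /andP [hc' hd'] eq_ll'; apply: val_inj => /=.
  have [pl sl] := partnP l; have [pl' sl'] := partnP l'.
  have [|_ _ _ b1] := move_beadP pl _ hc hd; rewrite ?sl //.
  have [|_ _ _ b2] := move_beadP pl' _ hc' hd'; rewrite ?sl' //.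
  apply: (@beta_inj N) => //; try by rewrite (leq_trans (size_partition _)) ?sl ?sl'.
  move=> x; have := b1 x; rewrite eq_ll' b2 !in_cons !mem_rem_uniq ?beta_uniq // !inE.
  have [->|xd] := eqVneq x d; first by rewrite hd hd'.
  by have [->|xc] := eqVneq x c; rewrite ?(negbTE hc) ?(negbTE hc') //= => ->.
rewrite cardE -(size_map (fun l : Defs.partn n => move_bead N c d l)).
rewrite (cardE B) -(size_map (@parts m)); apply: uniq_leq_size => // x /mapP [l].
rewrite mem_enum inE => /andP [hc hd] ->{x}.
have [pl sl] := partnP l.
have [|pm _ sm bm] := move_beadP pl _ hc hd; rewrite ?sl //.
have hm : is_partition (move_bead N c d l) && (sumn (move_bead N c d l) == m).
  by rewrite pm /=; lia.
apply/mapP; exists (PartN hm) => //; rewrite mem_enum inE /= !bm !in_cons eqxx /=.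
rewrite mem_rem_uniq ?beta_uniq // inE eqxx /= orbF.
by apply: contraNneq hc => <-.
Qed.

Lemma card_move_bead N n m c d : n <= N -> m <= N -> m + d = n + c ->
  #|[pred l : Defs.partn n | (c \notin beta N l) && (d \in beta N l)]| =
  #|[pred l : Defs.partn m | (c \in beta N l) && (d \notin beta N l)]|.
Proof.
move=> hn hm e; apply/eqP; rewrite eqn_leq leq_card_move_bead //=.
rewrite (eq_card (B := [pred l : Defs.partn m |
    (d \notin beta N l) && (c \in beta N l)])); last by move=> l; rewrite !inE andbC.
rewrite (leq_trans (leq_card_move_bead hm (esym e))) //.
by apply/eq_leq/eq_card => l; rewrite !inE andbC.
Qed.

Definition hooks_sum (k n : nat) : nat := \sum_(l : Defs.partn n) hooks k l.

Lemma hooks_sum_card k N n : 0 < k -> n <= N ->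
  hooks_sum k n = \sum_(c < N + N)
    #|[pred l : Defs.partn n | ((c : nat) \notin beta N l) && (c + k \in beta N l)]|.
Proof.
move=> k0 hn; rewrite /hooks_sum.
rewrite (eq_bigr (fun l : Defs.partn n => \sum_(c < N + N)
   ((c : nat) \notin beta N l) && (c + k \in beta N l) : nat)); last first.
  by move=> l _; have [pl sl] := partnP l; rewrite hooks_removable ?sl.
rewrite exchange_big /=; apply: eq_bigr => c _.
by rewrite -sum1_card [RHS]big_mkcond; apply: eq_bigr => l _; rewrite inE; case: (_ && _).
Qed.

(** Stripping a hook of length k would leave a partition of n - k, which is
    negative. *)
Lemma hooks_sum_small k n : n < k -> hooks_sum k n = 0.
Proof.
move=> hk; rewrite (hooks_sum_card (N := n)) //; last by lia.
rewrite big1 // => c _; apply: eq_card0 => l; rewrite inE; apply/negP => /andP [hc hd].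
have [pl sl] := partnP l.
by have [|_ _] := move_beadP pl _ hc hd; rewrite ?sl //; lia.
Qed.

(** Position by position, downward slides in partitions of n correspond to
    upward slides in partitions of n - k. *)
Lemma hooks_sum_rec k n : 0 < k -> k <= n ->
  hooks_sum k n = hooks_sum k (n - k) + k * num_partn (n - k).
Proof.
move=> k0 hk; rewrite (hooks_sum_card (N := n)) //.
rewrite (eq_bigr (fun c : 'I_(n + n) => #|[pred l : Defs.partn (n - k) |
   ((c : nat) \in beta n l) && (c + k \notin beta n l)]|)); last first.
  by move=> c _; apply: card_move_bead; lia.
rewrite (eq_bigr (fun c : 'I_(n + n) => \sum_(l : Defs.partn (n - k))
   ((c : nat) \in beta n l) && (c + k \notin beta n l) : nat)); last first.
  move=> c _; rewrite -sum1_card big_mkcond; apply: eq_bigr => l _.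
  by rewrite inE; case: (_ && _).
rewrite exchange_big /= /hooks_sum /num_partn -sum1_card big_distrr -big_split /=.
apply: eq_bigr => l _; have [pl sl] := partnP l.
by rewrite hooks_addable ?muln1 // sl subnK.
Qed.

(** * Parts of a given size over all partitions of n *)

(** The finite type is replaced by a duplicate-free list of plain sequences, so
    that bijections between partitions of different integers become
    permutations of lists. *)
Definition partitions (n : nat) : seq (seq nat) :=
  [seq parts l | l <- enum {: Defs.partn n}].

Lemma partitions_uniq n : uniq (partitions n).
Proof. by rewrite map_inj_uniq ?enum_uniq //; exact: val_inj. Qed.

Lemma mem_partitions n s : (s \in partitions n) = is_partition s && (sumn s == n).
Proof.
apply/mapP/idP => [[l _ ->]|hs]; first exact: partsP.
by exists (PartN hs); rewrite ?mem_enum.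
Qed.

Lemma sum_partitions n (F : seq nat -> nat) :
  \sum_(l : Defs.partn n) F l = \sum_(s <- partitions n) F s.
Proof. by rewrite big_map big_enum. Qed.

Lemma card_partitions n (a : pred (seq nat)) :
  #|[pred l : Defs.partn n | a l]| = count a (partitions n).
Proof.
rewrite count_map -size_filter cardE /enum_mem -filter_predI.
by rewrite (eq_filter (a2 := a \o @parts n)) // => l; rewrite /= !inE andbT.
Qed.

Definition insert_part (k : nat) (s : seq nat) : seq nat := sort geq (k :: s).

Lemma perm_insert_part k n : 0 < k -> k <= n ->
  perm_eq [seq s <- partitions n | k \in s]
          [seq insert_part k s | s <- partitions (n - k)].
Proof.
move=> k0 hk; have pi s : perm_eq (insert_part k s) (k :: s) by rewrite perm_sort.
apply: uniq_perm; rewrite ?filter_uniq ?partitions_uniq //.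
  rewrite map_inj_in_uniq ?partitions_uniq // => s s'.
  rewrite !mem_partitions => /andP [hs _] /andP [hs' _] e.
  apply: perm_partition => //; rewrite -(perm_cons k) -(permPl (pi s)) e; exact: pi.
move=> s; rewrite mem_filter mem_partitions; apply/andP/mapP.
  move=> [ks /andP [ps /eqP ss]]; exists (rem k s).
    rewrite mem_partitions; have := perm_sumn (perm_to_rem ks); rewrite ss /= => ->.
    rewrite addKn eqxx andbT; case/andP: ps => ps s0.
    rewrite /is_partition (subseq_sorted geq_trans (rem_subseq _ _)) //.
    by rewrite (contra (@mem_rem _ _ _ _)).
  apply: perm_partition => //; last first.
    by rewrite perm_sym (permPl (pi _)) perm_sym perm_to_rem.
  rewrite is_partition_sort in_cons negb_or eq_sym -lt0n k0 (contra (@mem_rem _ _ _ _)) //.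
  by case/andP: ps.
move=> [m]; rewrite mem_partitions => /andP [/andP [_ m0] /eqP sm] ->.
rewrite is_partition_sort (perm_sumn (pi m)) (perm_mem (pi m)) /= sm subnKC //.
by rewrite !in_cons negb_or !eqxx m0 eq_sym -lt0n k0.
Qed.

Definition mult_sum (k n : nat) : nat := \sum_(l : Defs.partn n) count_mem k l.

(** Inserting a part k into a partition of n - k raises the multiplicity of k by
    one and reaches each partition of n that has a part k. *)
Lemma mult_sum_rec k n : 0 < k -> k <= n ->
  mult_sum k n = mult_sum k (n - k) + num_partn (n - k).
Proof.
move=> k0 hk; rewrite /mult_sum (sum_partitions _ (count_mem k)) (bigID (fun s => k \in s)) /=.
rewrite [X in _ + X]big1 ?addn0; last by move=> s /count_memPn.
rewrite -big_filter (perm_big _ (perm_insert_part k0 hk)) big_map /=.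
rewrite (sum_partitions _ (count_mem k)) /num_partn -sum1_card.
rewrite (sum_partitions _ (fun=> 1)) -big_split /=; apply: eq_bigr => s _.
by rewrite (permP (permEl (perm_sort _ _))) /= eqxx addnC.
Qed.

Lemma mult_sum_small k n : n < k -> mult_sum k n = 0.
Proof.
move=> hk; apply: big1 => l _; apply/count_memPn; apply: contraL hk => /leq_sumn.
by have [_ ->] := partnP l; rewrite leqNgt.
Qed.

(** * Hooks and parts divisible by t *)

(** For k = 0 both sides vanish, since hook lengths are positive. *)
Lemma hooks_sum_mult k n : hooks_sum k n = k * mult_sum k n.
Proof.
case: (posnP k) => [->|k0].
  rewrite mul0n; apply: big1 => l _; apply/eqP.
  by rewrite -leqn0 leqNgt -has_count; apply/hasPn.
have [m] := ubnP n; elim: m n => // m IH n hn; case: (ltnP n k) => hk.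
  by rewrite hooks_sum_small // mult_sum_small // muln0.
by rewrite hooks_sum_rec // mult_sum_rec // mulnDr IH //; lia.
Qed.

Lemma sum_fibers (T : eqType) (f F : T -> nat) (G : nat -> nat) s M :
  {in s, forall x, f x < M /\ F x = G (f x)} ->
  \sum_(x <- s) F x = \sum_(k < M) G k * count (fun x => f x == k) s.
Proof.
move=> hM; under [RHS]eq_bigr do rewrite -sum1_count big_mkcond big_distrr.
rewrite /= exchange_big /= !big_seq; apply: eq_bigr => x /hM [hx ->].
rewrite (bigD1 (Ordinal hx)) //= eqxx muln1 big1 ?addn0 // => k.
by rewrite -(inj_eq val_inj) /= eq_sym => /negbTE ->; rewrite muln0.
Qed.

(** Read off hooks_sum_small: one longer hook would make that sum positive. *)
Lemma hook_length_leq l x : is_partition l -> x \in cells l -> hook_length l x <= sumn l.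
Proof.
move=> pl hx; rewrite leqNgt; apply/negP => h.
have hl : is_partition l && (sumn l == sumn l) by rewrite pl /=.
have := hooks_sum_small h; rewrite /hooks_sum (bigD1 (PartN hl)) //= => /eqP.
rewrite addn_eq0 => /andP [+ _]; rewrite -leqn0 leqNgt -has_count => /hasP; apply.
by exists x.
Qed.

Lemma weight_hooks t l : is_partition l ->
  weight t l = \sum_(k < (sumn l).+1) (t %| k) * hooks k l.
Proof.
move=> pl; rewrite /weight -sum1_count big_mkcond /=.
apply: (sum_fibers (G := dvdn t) (f := hook_length l)) => x hx.
by split; [rewrite ltnS hook_length_leq | case: (t %| _)].
Qed.

Definition div_part_sum (t : nat) (l : seq nat) : nat := sumn [seq x <- l | t %| x].

Lemma div_part_sum_mult t l :
  div_part_sum t l = \sum_(k < (sumn l).+1) (t %| k) * k * count_mem (k : nat) l.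
Proof.
rewrite /div_part_sum sumnE big_filter big_mkcond /=.
apply: (sum_fibers (G := fun k => (t %| k) * k) (f := id)) => x hx.
by split; [rewrite ltnS leq_sumn | case: (t %| x); rewrite ?mul1n].
Qed.

Lemma sum_weight t n :
  \sum_(l : Defs.partn n) weight t l = \sum_(l : Defs.partn n) div_part_sum t l.
Proof.
transitivity (\sum_(k < n.+1) (t %| k) * hooks_sum k n).
  under [RHS]eq_bigr do rewrite big_distrr.
  rewrite /= exchange_big /=; apply: eq_bigr => l _; have [pl sl] := partnP l.
  by rewrite weight_hooks // sl.
under eq_bigr do rewrite hooks_sum_mult mulnA big_distrr.
rewrite /= exchange_big /=; apply: eq_bigr => l _; have [pl sl] := partnP l.
by rewrite div_part_sum_mult sl.
Qed.

(** * Splitting off the parts divisible by t *)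

Definition scaled_union (t : nat) (a b : seq nat) : seq nat :=
  sort geq ([seq t * x | x <- a] ++ b).

(** Filtering by divisibility by t recovers both components, hence
    scaled_union is injective on the pairs of interest. *)
Lemma filter_scaled_union t a b :
  0 < t -> is_partition a -> is_partition b -> regular t b ->
  [seq x <- scaled_union t a b | t %| x] = [seq t * x | x <- a] /\
  [seq x <- scaled_union t a b | ~~ (t %| x)] = b.
Proof.
move=> t0 /andP [sa _] /andP [sb _] /allP rb.
rewrite /scaled_union !filter_sort; try exact: geq_trans; try exact: geq_total.
rewrite !filter_cat.
have -> : [seq x <- [seq t * x | x <- a] | t %| x] = [seq t * x | x <- a].
  by apply/all_filterP/allP => x /mapP [y _ ->]; exact: dvdn_mulr.
have -> : [seq x <- [seq t * x | x <- a] | ~~ (t %| x)] = [::].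
  apply/eqP; rewrite -(negbK (_ == _)) -has_filter; apply/hasPn => x /mapP [y _ ->].
  by rewrite negbK dvdn_mulr.
have -> : [seq x <- b | t %| x] = [::].
  by apply/eqP; rewrite -(negbK (_ == _)) -has_filter; apply/hasPn => x /rb.
have -> : [seq x <- b | ~~ (t %| x)] = b by apply/all_filterP/allP.
rewrite cats0; split; apply: sorted_sort => //; try exact: geq_trans.
by rewrite sorted_map; apply: sub_sorted sa => x y /= h; rewrite leq_mul2l h orbT.
Qed.

Lemma sumn_scale t a : sumn [seq t * x | x <- a] = t * sumn a.
Proof. by rewrite !sumnE big_map big_distrr. Qed.

(** The partitions whose parts divisible by t sum to j are the scaled unions of
    a partition of j / t and a t-regular partition of n - j. *)
Lemma count_div_part_sum t n j : 0 < t -> j <= n -> t %| j ->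
  count (fun s => div_part_sum t s == j) (partitions n) =
  num_partn (j %/ t) * num_regular t (n - j).
Proof.
move=> t0 hj tj.
have -> : num_partn (j %/ t) = size (partitions (j %/ t)) by rewrite size_map -cardE.
have -> : num_regular t (n - j) = size [seq s <- partitions (n - j) | regular t s].
  by rewrite size_filter -card_partitions; apply: eq_card => l; rewrite !inE.
rewrite -size_filter -(size_allpairs (scaled_union t)); apply/perm_size/uniq_perm.
- by rewrite filter_uniq // partitions_uniq.
- apply: allpairs_uniq; rewrite ?filter_uniq ?partitions_uniq //.
  move=> [a b] [a' b'] /allpairsP [[? ?] [/= ha hb [-> ->]]].
  move=> /allpairsP [[? ?] [/= ha' hb' [-> ->]]].
  move: ha ha' hb hb'; rewrite !mem_filter !mem_partitions.
  move=> /andP [pa _] /andP [pa' _] /and3P [rb pb _] /and3P [rb' pb' _] e.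
  have [ea eb] := filter_scaled_union t0 pa pb rb.
  have [ea' eb'] := filter_scaled_union t0 pa' pb' rb'.
  have inj_t : injective (muln t) by move=> x y /eqP; rewrite eqn_pmul2l // => /eqP.
  congr (_, _); last by rewrite -eb e eb'.
  by apply: (inj_map inj_t); rewrite -ea e ea'.
move=> s; rewrite mem_filter mem_partitions; apply/and3P/allpairsP.
  move=> [/eqP ds ps /eqP ss]; case/andP: (ps) => so s0.
  set u := [seq x <- s | t %| x]; set v := [seq x <- s | ~~ (t %| x)].
  have uE : [seq t * x | x <- [seq x %/ t | x <- u]] = u.
    rewrite -map_comp -[RHS]map_id; apply/eq_in_map => x.
    rewrite mem_filter => /andP [h _] /=; by rewrite mulnC divnK.
  have puv : perm_eq (u ++ v) s by rewrite perm_filterC.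
  have su : sumn u = j by [].
  exists ([seq x %/ t | x <- u], v); rewrite !mem_filter !mem_partitions /=; split.
  - apply/andP; split; last first.
      by rewrite -(eqn_pmul2l t0) -sumn_scale uE su mulnC divnK.
    apply/andP; split.
      have su' : sorted geq u by apply: sorted_filter => //; exact: geq_trans.
      rewrite sorted_map; move: su'.
      by apply: sub_sorted => x y /= h; exact: leq_div2r.
    apply: contra s0 => /mapP [x]; rewrite mem_filter => /andP [h xs] e.
    by rewrite -(divnK h) -e mul0n in xs.
  - apply/and3P; split; first by apply/allP => x; rewrite mem_filter => /andP [].
      rewrite /is_partition sorted_filter //=; last exact: geq_trans.
      by rewrite mem_filter negb_and s0 orbT.
    by have := perm_sumn puv; rewrite sumn_cat su ss => <-; rewrite addKn.
  apply: perm_partition => //; rewrite /scaled_union uE.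
    by rewrite is_partition_sort (perm_mem puv).
  by rewrite perm_sym perm_sort.
move=> [[a b] [/=]]; rewrite mem_filter !mem_partitions.
move=> /andP [pa /eqP sa] /and3P [rb pb /eqP sb] ->.
have [fa fb] := filter_scaled_union t0 pa pb rb.
rewrite /div_part_sum fa sumn_scale sa mulnC divnK // eqxx; split=> //.
  rewrite is_partition_sort mem_cat negb_or; case/andP: pb => _ ->; rewrite andbT.
  apply/mapP => -[x xa /esym/eqP]; rewrite muln_eq0 => /orP [/eqP e|/eqP e].
    by rewrite e in t0.
  by case/andP: pa => _; rewrite -e xa.
rewrite (perm_sumn (permEl (perm_sort _ _))) sumn_cat sumn_scale sa sb.
by rewrite mulnC divnK // subnKC.
Qed.

Lemma sum_div_part_sum t n : 0 < t ->
  \sum_(l : Defs.partn n) div_part_sum t l =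
  \sum_(j < n.+1 | t %| j) j * num_partn (j %/ t) * num_regular t (n - j).
Proof.
move=> t0; rewrite (sum_partitions _ (div_part_sum t)).
have dE s : div_part_sum t s + sumn [seq x <- s | ~~ (t %| x)] = sumn s.
  by rewrite -sumn_cat; apply: perm_sumn; rewrite perm_filterC.
rewrite (sum_fibers (f := div_part_sum t) (G := id) (M := n.+1)); last first.
  by move=> s; rewrite mem_partitions => /andP [_ /eqP ss]; have := dE s; lia.
rewrite [RHS]big_mkcond /=; apply: eq_bigr => j _; case: ifP => tj.
  by rewrite count_div_part_sum ?mulnA // -ltnS.
(* A sum of multiples of t is never equal to j when t does not divide j. *)
apply/eqP; rewrite muln_eq0 -[X in _ || X]leqn0 leqNgt -has_count.
apply/orP; right; apply/hasPn => s _; apply: contraFN tj => /eqP <-.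
by rewrite /div_part_sum sumnE big_filter; apply: dvdn_sum.
Qed.

Lemma core_size_sum_complement t n : 0 < t ->
  core_size_sum t n + t * \sum_(j < n.+1 | t %| j)
    j * num_partn (j %/ t) * num_regular t (n - j) = n * num_partn n.
Proof.
move=> t0; rewrite -sum_div_part_sum // -sum_weight big_distrr -big_split /=.
rewrite (eq_bigr (fun=> n)) ?sum_nat_const 1?mulnC // => l _.
by have [pl sl] := partnP l; rewrite sumn_core.
Qed.

Local Open Scope ring_scope.

Theorem corollary1p6 (t n : nat) (ht : (2 <= t)%N) :
  (core_size_sum t n)%:Z =
  (n * num_partn n)%N%:Z -
  (t * \sum_(j < n.+1 | t %| j)
         j * num_partn (j %/ t) * num_regular t (n - j))%N%:Z.
Proof.
by rewrite -(core_size_sum_complement n (ltnW ht)) PoszD GRing.addrK.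
Qed.
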